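(* Let $b\in\mathbb R^N$, $\sigma>0$, let $H\in\mathbb R^{N\times N}$ be a convolutional operator, and let $T$ be a real matrix with $N$ columns such that $T^{\mathsf T}T$ is a convolutional operator. Assume that $H^{\mathsf T}H+\lambda T^{\mathsf T}T$ is invertible for every $\lambda>0$, and for $\lambda>0$ put $M=M(\lambda)=(H^{\mathsf T}H+\lambda T^{\mathsf T}T)^{-1}$ and let $$u=u(\lambda)=\arg\min_{v\in\mathbb R^N}\ \|Hv-b\|_2^2+\lambda\|Tv\|_2^2=MH^{\mathsf T}b$$ be the Tikhonov regularized solution. If $\lambda>0$ minimizes over $(0,\infty)$ the SURE criterion $$-N\sigma^2+\|Hu-b\|_2^2+2\sigma^2\,\mathrm{trace}(HMH^{\mathsf T}),$$ then, provided the denominator below is nonzero, $$\lambda=\frac{\sigma^2\,\mathrm{trace}\big(HMT^{\mathsf T}TMH^{\mathsf T}\big)}{b^{\mathsf T}HMT^{\mathsf T}TMT^{\mathsf T}TMH^{\mathsf T}b},$$ where $M=M(\lambda)$ on the right-hand side.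
   Context: Images are of size $m\times n$ with $N=mn$, identified with vectors in $\mathbb R^N$; $\mathcal F$ denotes the unitary 2D discrete Fourier transform on $\mathbb C^N$. A convolutional operator is a real matrix $A\in\mathbb R^{N\times N}$ acting as 2D circular convolution with a fixed real kernel; equivalently, a real matrix of the form $A=\mathcal F^{-1}\hat A\mathcal F$ with $\hat A$ diagonal (possibly complex). The data $b$, $\sigma$, $H$, $T$ do not depend on $\lambda$. *)

(* Defs.v *)
From mathcomp Require Import all_boot all_order all_algebra.
From mathcomp Require Import reals.
Set Implicit Arguments.
Unset Strict Implicit.
Unset Printing Implicit Defensive.
Import Order.TTheory GRing.Theory Num.Theory.
Local Open Scope ring_scope.

(* [(i - p) mod m] on the indices [0, ..., m - 1]. *)
Definition circ_sub (m : nat) (i p : 'I_m) : 'I_m :=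
  Ordinal (ltn_pmod (i + (m - p)) (leq_ltn_trans (leq0n i) (ltn_ord i))).

Definition circ_conv (R : realType) (m n : nat) (K X : 'M[R]_(m, n)) :
    'M[R]_(m, n) :=
  \matrix_(i, j) \sum_(p < m) \sum_(q < n)
     K p q * X (circ_sub i p) (circ_sub j q).

(* The identification of images with vectors (row-major, as [mxvec]). *)
Definition image_vec (R : realType) (m n : nat) (X : 'M[R]_(m, n)) :
    'cV[R]_(m * n) := (mxvec X)^T.

(* The kernel is a full m x n image: by periodicity this covers kernels of any
   (finite) support. *)
Definition convolutional (R : realType) (m n : nat) (A : 'M[R]_(m * n)) : Prop :=
  exists K : 'M[R]_(m, n), forall X : 'M[R]_(m, n),
    A *m image_vec X = image_vec (circ_conv K X).

(* The Euclidean norm; MathComp-Analysis' norm on matrices is the sup norm. *)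
Definition norm2 (R : realType) (k : nat) (v : 'cV[R]_k) : R :=
  Num.sqrt (\sum_(i < k) v i 0 ^+ 2).

Definition is_argmin (R : realType) (V : Type) (f : V -> R) (v : V) : Prop :=
  forall w : V, f v <= f w.

Section Tikhonov.
Variables (R : realType) (N p : nat).
Variables (H : 'M[R]_N) (T : 'M[R]_(p, N)) (b : 'cV[R]_N).

Definition tik_mx (lambda : R) : 'M[R]_N := H^T *m H + lambda *: (T^T *m T).

Definition tik_inv (lambda : R) : 'M[R]_N := invmx (tik_mx lambda).

Definition tik_obj (lambda : R) (v : 'cV[R]_N) : R :=
  norm2 (H *m v - b) ^+ 2 + lambda * norm2 (T *m v) ^+ 2.

Definition tik_sol (lambda : R) : 'cV[R]_N := tik_inv lambda *m H^T *m b.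

Definition sure (sigma lambda : R) : R :=
  - (N%:R * sigma ^+ 2) + norm2 (H *m tik_sol lambda - b) ^+ 2
  + 2 * sigma ^+ 2 * \tr (H *m tik_inv lambda *m H^T).

End Tikhonov.

(* Main.v *)
Require Import Defs.
From mathcomp Require Import all_boot all_order all_algebra all_fingroup.
From mathcomp Require Import boolp classical_sets reals topology normedtype.
From mathcomp Require Import ring lra.
Set Implicit Arguments.
Unset Strict Implicit.
Unset Printing Implicit Defensive.
Import Order.TTheory GRing.Theory Num.Theory.
Import numFieldTopology.Exports numFieldNormedType.Exports.
Local Open Scope ring_scope.


(** Convolutional matrices are combinations of the permutation matrices of the
    cyclic translations of the image grid ([convolutional_sum]).  Translations
    commute with each other, hence also with each other's inverses, which are
    the transposes; so H, H^T and G = T^T T commute pairwise, and so does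
    M = (H^T H + lambda G)^-1 with each of them.  This is how the simultaneous
    diagonalization by the Fourier transform enters.

    For the first claim, the normal equation kills the cross term in the
    objective at u + w, leaving the positive definite quadratic form
    |H w|^2 + lambda |T w|^2 ([tik_obj_add]).

    For the second claim, the minimizer lambda is interior, so the derivative
    of the criterion vanishes.  The derivative is replaced by a difference
    quotient: the resolvent identity
      M(mu) - M(lambda) = (lambda - mu) M(mu) G M(lambda)
    factors the increment of the criterion exactly as (lambda - mu) times
    [sure_slope] ([sure_sub]).  Minimality makes this product nonnegative for
    all mu > 0, so the slope changes sign at mu = lambda; being continuous
    there, since M(mu) is by Cramer's rule, it vanishes
    ([sure_minimizer_slope]).

    It remains to evaluate the slope at mu = lambda.  Commutation gives
    H M H^T = M (H^T H + lambda G) - lambda M G = 1 - lambda M G, hence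
    H u - b = - lambda M G b ([residual_normal]): this is where the factor
    lambda comes from.  Commuting H^T past M G turns the slope into
      - 2 lambda den + 2 sigma^2 tr(H M G M H^T),
    with den the denominator of the claim. *)

(** * Circular convolutions commute with each other and with transposes *)

Lemma circ_sub_inj (m : nat) (p : 'I_m) : injective (fun i => circ_sub i p).
Proof.
move=> i i' /(congr1 val) /= /eqP; rewrite eqn_modDr !modn_small // => /eqP.
exact: val_inj.
Qed.

Lemma circ_subAC (m : nat) (i p p' : 'I_m) :
  circ_sub (circ_sub i p) p' = circ_sub (circ_sub i p') p.
Proof. by apply: val_inj; rewrite /= !modnDml addnAC. Qed.

(** The translation of the pixel grid by (- p, - q), acting on the row-major
    positions of the pixels. *)
Definition translate_index (m n : nat) (p : 'I_m) (q : 'I_n) (k : 'I_(m * n)) :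
    'I_(m * n) :=
  let ij := enum_val (cast_ord (esym (mxvec_cast m n)) k) in
  mxvec_index (circ_sub ij.1 p) (circ_sub ij.2 q).

Lemma translate_indexE (m n : nat) (p i : 'I_m) (q j : 'I_n) :
  translate_index p q (mxvec_index i j)
  = mxvec_index (circ_sub i p) (circ_sub j q).
Proof. by rewrite /translate_index /mxvec_index cast_ordK enum_rankK. Qed.

Lemma mxvec_index_inj (m n : nat) (i i' : 'I_m) (j j' : 'I_n) :
  mxvec_index i j = mxvec_index i' j' -> i = i' /\ j = j'.
Proof. by move=> /cast_ord_inj /enum_rank_inj [-> ->]. Qed.

Lemma translate_index_inj (m n : nat) (p : 'I_m) (q : 'I_n) :
  injective (translate_index p q).
Proof.
move=> k k'; case/mxvec_indexP: k => i j; case/mxvec_indexP: k' => i' j'.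
rewrite !translate_indexE => /mxvec_index_inj [].
by move=> /circ_sub_inj -> /circ_sub_inj ->.
Qed.

Definition translation (m n : nat) (p : 'I_m) (q : 'I_n) : 'S_(m * n) :=
  perm (@translate_index_inj m n p q).

Lemma translationC (m n : nat) (p p' : 'I_m) (q q' : 'I_n) :
  commute (translation p q) (translation p' q').
Proof.
apply/permP => k; case/mxvec_indexP: k => i j; rewrite !permM !permE.
by rewrite !translate_indexE (circ_subAC i) (circ_subAC j).
Qed.

(** Both sides act in the same way on vectorized images, and every vector is
    one; evaluating at basis vectors then compares the entries. *)
Lemma convolutional_sum (R : realType) (m n : nat) (A : 'M[R]_(m * n)) :
  convolutional A ->
  exists K : 'M[R]_(m, n),
    A = \sum_p \sum_q K p q *: perm_mx (translation p q).
Proof.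
move=> [K AK]; exists K.
have imgK v : v = image_vec (vec_mx v^T : 'M[R]_(m, n)).
  by rewrite /image_vec vec_mxK trmxK.
have actE (v : 'cV_(m * n)) :
    A *m v = (\sum_p \sum_q K p q *: perm_mx (translation p q)) *m v.
  rewrite (imgK v) AK; move: (vec_mx _) => X.
  apply/colP => k; case/mxvec_indexP: k => i j.
  rewrite /image_vec mulmx_suml summxE mxE mxvecE mxE; apply: eq_bigr => p _.
  rewrite mulmx_suml summxE; apply: eq_bigr => q _.
  by rewrite -scalemxAl -row_permE !mxE permE translate_indexE mxvecE.
apply/matrixP => k l.
have := congr1 (fun B : 'cV_ _ => B k 0) (actE (delta_mx l 0)).
by rewrite -!colE !mxE.
Qed.

Lemma convolutional_comm (R : realType) (m n : nat) (A B : 'M[R]_(m * n)) :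
  convolutional A -> convolutional B -> comm_mx A B.
Proof.
move=> /convolutional_sum [K ->] /convolutional_sum [L ->].
apply: comm_mx_sum => p _; apply: comm_mx_sum => q _; apply: comm_mx_sym.
apply: comm_mx_sum => p' _; apply: comm_mx_sum => q' _.
rewrite /comm_mx -!scalemxAl -!scalemxAr !scalerA mulrC.
by rewrite -!perm_mxM translationC.
Qed.

(** The transpose of a permutation matrix is that of the inverse permutation,
    which still commutes with whatever the permutation commutes with. *)
Lemma convolutional_comm_tr (R : realType) (m n : nat) (A B : 'M[R]_(m * n)) :
  convolutional A -> convolutional B -> comm_mx A B^T.
Proof.
move=> /convolutional_sum [K ->] /convolutional_sum [L ->].
rewrite linear_sum; apply: comm_mx_sum => p _.
rewrite linear_sum; apply: comm_mx_sum => q _; apply: comm_mx_sym.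
apply: comm_mx_sum => p' _; apply: comm_mx_sum => q' _.
rewrite linearZ /= /comm_mx -!scalemxAl -!scalemxAr !scalerA mulrC tr_perm_mx.
by rewrite -!perm_mxM (commuteV (translationC p' p q' q)).
Qed.

Lemma comm_mx_inv (R : comUnitRingType) (n : nat) (A B : 'M[R]_n) :
  B \in unitmx -> comm_mx A B -> comm_mx A (invmx B).
Proof.
move=> uB AB; rewrite /comm_mx -[LHS](mulKmx uB).
by rewrite [B *m _]mulmxA -(AB : A *m B = B *m A) mulmxK.
Qed.

(** * Tikhonov solutions *)

Lemma entryD (R : realType) (m n : nat) (A B : 'M[R]_(m, n)) i j :
  (A + B) i j = A i j + B i j.
Proof. by rewrite mxE. Qed.

Lemma entryB (R : realType) (m n : nat) (A B : 'M[R]_(m, n)) i j :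
  (A - B) i j = A i j - B i j.
Proof. by rewrite !mxE. Qed.

Lemma entryZ (R : realType) (m n : nat) (a : R) (A : 'M[R]_(m, n)) i j :
  (a *: A) i j = a * A i j.
Proof. by rewrite mxE. Qed.

Lemma norm2_sqr (R : realType) (k : nat) (v : 'cV[R]_k) :
  norm2 v ^+ 2 = (v^T *m v) 0 0.
Proof.
rewrite sqr_sqrtr ?sumr_ge0 // => [|i _]; last exact: sqr_ge0.
by rewrite mxE; apply: eq_bigr => i _; rewrite mxE expr2.
Qed.

Lemma norm2_eq0 (R : realType) (k : nat) (v : 'cV[R]_k) :
  norm2 v ^+ 2 = 0 -> v = 0.
Proof.
rewrite sqr_sqrtr ?sumr_ge0 // => [|i _]; last exact: sqr_ge0.
move=> v0; apply/colP => i; rewrite mxE; apply/eqP; rewrite -sqrf_eq0.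
by apply/eqP/(psumr_eq0P _ v0) => // j _; exact: sqr_ge0.
Qed.

Lemma dotC (R : realType) (k : nat) (u v : 'cV[R]_k) :
  (u^T *m v) 0 0 = (v^T *m u) 0 0.
Proof. by rewrite -{2}(trmxK u) -trmx_mul [RHS]mxE. Qed.

Lemma norm2_addE (R : realType) (k : nat) (u v : 'cV[R]_k) :
  norm2 (u + v) ^+ 2 = norm2 u ^+ 2 + 2 * (v^T *m u) 0 0 + norm2 v ^+ 2.
Proof.
rewrite !norm2_sqr [(u + v)^T]linearD /= mulmxDl !mulmxDr !entryD (dotC u v).
by rewrite mulr_natl mulr2n !addrA.
Qed.

Lemma tik_mx_tr (R : realType) (N p : nat) (H : 'M[R]_N) (T : 'M[R]_(p, N))
    (lambda : R) : (tik_mx H T lambda)^T = tik_mx H T lambda.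
Proof. by rewrite [LHS]linearD /= [(_ *: _)^T]linearZ /= !trmx_mul !trmxK. Qed.

(** Completing the square: u solves the normal equation
    (H^T H + lambda T^T T) u = H^T b, so the terms linear in w cancel. *)
Lemma tik_obj_add (R : realType) (N p : nat) (H : 'M[R]_N) (T : 'M[R]_(p, N))
    (b : 'cV[R]_N) (lambda : R) (w : 'cV[R]_N) :
  tik_mx H T lambda \in unitmx ->
  tik_obj H T b lambda (tik_sol H T b lambda + w) =
  tik_obj H T b lambda (tik_sol H T b lambda)
  + (norm2 (H *m w) ^+ 2 + lambda * norm2 (T *m w) ^+ 2).
Proof.
move=> uX; set u := tik_sol H T b lambda.
have Xu : H^T *m H *m u + lambda *: (T^T *m T *m u) = H^T *m b.
  rewrite scalemxAl -mulmxDl -/(tik_mx H T lambda) /u /tik_sol.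
  by rewrite -!mulmxA mulKVmx.
have cross : ((H *m w)^T *m (H *m u - b)) 0 0
    + lambda * ((T *m w)^T *m (T *m u)) 0 0 = 0.
  have /(congr1 (fun v : 'cV_N => (w^T *m (v - H^T *m b)) 0 0)) := Xu.
  rewrite subrr mulmx0 [RHS]mxE => <-.
  rewrite !trmx_mul -!mulmxA !mulmxBr mulmxDr -scalemxAr !mulmxA.
  by rewrite !entryB entryD entryZ addrAC.
rewrite /tik_obj !mulmxDr addrAC !(norm2_addE _ (_ *m w)).
move: cross; set c : R := (_ *m _) 0 0; set d : R := (_ *m _) 0 0.
move=> /addr0_eq cd; have -> : c = - (lambda * d) by rewrite -cd opprK.
ring.
Qed.

(** Uniqueness: at a minimizer u + w both H w and T w vanish, so w lies in the
    kernel of the invertible matrix H^T H + lambda T^T T. *)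
Lemma tik_argminP (R : realType) (N p : nat) (H : 'M[R]_N) (T : 'M[R]_(p, N))
    (b : 'cV[R]_N) (lambda : R) (v : 'cV[R]_N) :
  0 < lambda -> tik_mx H T lambda \in unitmx ->
  is_argmin (tik_obj H T b lambda) v <-> v = tik_sol H T b lambda.
Proof.
move=> l0 uX; set u := tik_sol H T b lambda; split=> [vmin | -> w]; last first.
  rewrite -[w](subrK u) addrC tik_obj_add // lerDl.
  by apply: addr_ge0; [exact: sqr_ge0 | exact: mulr_ge0 (ltW l0) (sqr_ge0 _)].
have := vmin u; rewrite -[v](subrK u) [_ + u]addrC; move: (v - u) => w.
rewrite tik_obj_add // gerDl => le0.
have H0 := sqr_ge0 (norm2 (H *m w)).
have T0 := mulr_ge0 (ltW l0) (sqr_ge0 (norm2 (T *m w))).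
have /norm2_eq0 Hw : norm2 (H *m w) ^+ 2 = 0 by lra.
have /eqP : lambda * norm2 (T *m w) ^+ 2 = 0 by lra.
rewrite mulf_eq0 gt_eqF //= => /eqP /norm2_eq0 Tw.
suff -> : w = 0 by rewrite addr0.
rewrite -(mulKmx uX w) /tik_mx mulmxDl -scalemxAl -!mulmxA Hw Tw.
by rewrite !mulmx0 scaler0 addr0 mulmx0.
Qed.

(** * The stationarity condition *)

(** The resolvent identity. *)
Lemma tik_inv_sub (R : realType) (N p : nat) (H : 'M[R]_N) (T : 'M[R]_(p, N))
    (lambda mu : R) :
  tik_mx H T lambda \in unitmx -> tik_mx H T mu \in unitmx ->
  tik_inv H T mu - tik_inv H T lambda =
  (lambda - mu) *: (tik_inv H T mu *m (T^T *m T) *m tik_inv H T lambda).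
Proof.
move=> ul um; rewrite /tik_inv.
have XX : (lambda - mu) *: (T^T *m T) = tik_mx H T lambda - tik_mx H T mu.
  by rewrite /tik_mx opprD addrACA subrr add0r -scalerBl.
rewrite scalemxAl scalemxAr XX mulmxBr mulmxBl mulVmx // mul1mx.
by rewrite mulmxK.
Qed.

Definition residual (R : realType) (N p : nat) (H : 'M[R]_N)
    (T : 'M[R]_(p, N)) (b : 'cV[R]_N) (lambda : R) : 'cV[R]_N :=
  H *m tik_sol H T b lambda - b.

(** Minus the difference quotient of the SURE criterion between lambda and mu,
    written without division so that it still makes sense at mu = lambda,
    where it is minus the derivative.  The sum of the two residuals comes from
    |r'|^2 - |r|^2 = <r' - r, r' + r>. *)
Definition sure_slope (R : realType) (N p : nat) (H : 'M[R]_N)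
    (T : 'M[R]_(p, N)) (b : 'cV[R]_N) (sigma lambda mu : R) : R :=
  let D := H *m (tik_inv H T mu *m (T^T *m T) *m tik_inv H T lambda) *m H^T in
  ((D *m b)^T *m (residual H T b mu + residual H T b lambda)) 0 0
  + 2 * sigma ^+ 2 * \tr D.

Lemma sure_sub (R : realType) (N p : nat) (H : 'M[R]_N) (T : 'M[R]_(p, N))
    (b : 'cV[R]_N) (sigma lambda mu : R) :
  tik_mx H T lambda \in unitmx -> tik_mx H T mu \in unitmx ->
  sure H T b sigma mu - sure H T b sigma lambda =
  (lambda - mu) * sure_slope H T b sigma lambda mu.
Proof.
move=> ul um; rewrite /sure_slope /sure -!/(residual _ _ _ _).
set D := H *m (_ *m _) *m _.
have DE : H *m tik_inv H T mu *m H^T - H *m tik_inv H T lambda *m H^T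
    = (lambda - mu) *: D.
  by rewrite -mulmxBl -mulmxBr tik_inv_sub // -scalemxAr -scalemxAl.
have rE : residual H T b mu = residual H T b lambda + (lambda - mu) *: (D *m b).
  rewrite scalemxAl -DE /residual /tik_sol !mulmxBl !mulmxA.
  by rewrite [RHS]addrC addrA subrK.
have trE : \tr (H *m tik_inv H T mu *m H^T)
    = \tr (H *m tik_inv H T lambda *m H^T) + (lambda - mu) * \tr D.
  by rewrite -mxtraceZ -DE raddfB /= addrC subrK.
rewrite trE rE norm2_addE; move: (residual _ _ _ _) (D *m b) => r d.
rewrite (norm2_sqr (_ *: d)) [(_ *: d)^T]linearZ /=.
rewrite !mulmxDr -!scalemxAr -!scalemxAl.

rewrite !entryD !entryZ; ring.
Qed.

(** * Continuity of the resolvent *)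

Local Open Scope classical_set_scope.

(** Entrywise convergence, so that the rules below reduce to those for sums
    and products of reals. *)
Definition mx_cvg (R : realType) (m n : nat) (F : set_system R)
    (A : R -> 'M[R]_(m, n)) (L : 'M[R]_(m, n)) :=
  forall i j, A x i j @[x --> F] --> L i j.

Lemma mx_cvg_cst (R : realType) (m n : nat) (F : set_system R) {FF : Filter F}
    (L : 'M[R]_(m, n)) : mx_cvg F (fun=> L) L.
Proof. by move=> i j; exact: cvg_cst. Qed.

Lemma mx_cvgD (R : realType) (m n : nat) (F : set_system R) {FF : Filter F}
    (A B : R -> 'M[R]_(m, n)) (K L : 'M[R]_(m, n)) :
  mx_cvg F A K -> mx_cvg F B L -> mx_cvg F (fun x => A x + B x) (K + L).
Proof.
move=> AK BL i j; rewrite mxE; under eq_fun do rewrite mxE.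
exact: cvgD (AK i j) (BL i j).
Qed.

Lemma mx_cvgZ (R : realType) (m n : nat) (F : set_system R) {FF : Filter F}
    (s : R -> R) (A : R -> 'M[R]_(m, n)) (k : R) (L : 'M[R]_(m, n)) :
  s x @[x --> F] --> k -> mx_cvg F A L ->
  mx_cvg F (fun x => s x *: A x) (k *: L).
Proof.
move=> sk AL i j; rewrite mxE; under eq_fun do rewrite mxE.
exact: cvgM sk (AL i j).
Qed.

Lemma mx_cvg_tr (R : realType) (m n : nat) (F : set_system R)
    (A : R -> 'M[R]_(m, n)) (L : 'M[R]_(m, n)) :
  mx_cvg F A L -> mx_cvg F (fun x => (A x)^T) L^T.
Proof.
by move=> AL i j; rewrite mxE; under eq_fun do rewrite mxE; exact: AL.
Qed.

Lemma mx_cvgM (R : realType) (m n p : nat) (F : set_system R) {FF : Filter F}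
    (A : R -> 'M[R]_(m, n)) (B : R -> 'M[R]_(n, p)) K L :
  mx_cvg F A K -> mx_cvg F B L -> mx_cvg F (fun x => A x *m B x) (K *m L).
Proof.
move=> AK BL i j; rewrite mxE; under eq_fun do rewrite mxE.
apply: cvg_big => [|k _]; first exact: add_continuous.
exact: cvgM (AK i k) (BL k j).
Qed.

Lemma mx_cvg_trace (R : realType) (n : nat) (F : set_system R) {FF : Filter F}
    (A : R -> 'M[R]_n) L :
  mx_cvg F A L -> \tr (A x) @[x --> F] --> \tr L.
Proof.
by move=> AL; apply: cvg_big => [|k _]; [exact: add_continuous | exact: AL].
Qed.

Lemma mx_cvg_det (R : realType) (n : nat) (F : set_system R) {FF : Filter F}
    (A : R -> 'M[R]_n) L :
  mx_cvg F A L -> \det (A x) @[x --> F] --> \det L.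
Proof.
move=> AL; apply: cvg_big => [|s _]; first exact: add_continuous.
apply: cvgM; first exact: cvg_cst.
by apply: cvg_big => [|i _]; [exact: mul_continuous | exact: AL].
Qed.

Lemma mx_cvg_adj (R : realType) (n : nat) (F : set_system R) {FF : Filter F}
    (A : R -> 'M[R]_n) L :
  mx_cvg F A L -> mx_cvg F (fun x => \adj (A x)) (\adj L).
Proof.
move=> AL i j; rewrite mxE; under eq_fun do rewrite mxE.
apply: cvgM; first exact: cvg_cst.
apply: mx_cvg_det => k l; rewrite !mxE; under eq_fun do rewrite !mxE.
exact: AL.
Qed.

(** By Cramer's rule, near F the inverse is the adjugate over the determinant. *)
Lemma mx_cvg_inv (R : realType) (n : nat) (F : set_system R) {FF : Filter F}
    (A : R -> 'M[R]_n) L :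
  L \in unitmx -> {near F, forall x, A x \in unitmx} ->
  mx_cvg F A L -> mx_cvg F (fun x => invmx (A x)) (invmx L).
Proof.
move=> uL uA AL; have dL : \det L != 0 by move: uL; rewrite unitmxE unitfE.
rewrite /invmx uL => i j.
have cramer : ((\det (A x))^-1 *: \adj (A x)) i j @[x --> F]
    --> ((\det L)^-1 *: \adj L) i j.
  exact: mx_cvgZ (cvgV dL (mx_cvg_det AL)) (mx_cvg_adj AL) i j.
apply: cvg_trans cramer.
by apply: near_eq_cvg; near=> x; rewrite (near uA x).
Unshelve. all: by end_near. Qed.

(** The two one-sided limits of f at l bound f l from either side.  The factor
    l - x carries no information at x = l itself, hence the need for
    continuity. *)
Lemma eq0_of_sign_change (R : realType) (f : R -> R) (l : R) :
  0 < l -> f x @[x --> l] --> f l ->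
  (forall x, 0 < x -> 0 <= (l - x) * f x) -> f l = 0.
Proof.
move=> l0 fl sgn; apply/eqP; rewrite eq_le.
apply/andP; split; rewrite leNgt; apply/negP.
- move=> fl0; have fr : f x @[x --> l^'+] --> f l by exact: cvg_at_right_filter.
  near l^'+ => x.
  have lx : l < x by near: x; exact: nbhs_right_gt.
  have fx : 0 < f x by near: x; exact: (cvgr_gt _ fr).
  have := sgn x (lt_trans l0 lx); rewrite leNgt => /negP; apply.
  by rewrite nmulr_rlt0 // subr_lt0.
- move=> fl0; have fr : f x @[x --> l^'-] --> f l by exact: cvg_at_left_filter.
  near l^'- => x.
  have lx : x < l by near: x; exact: nbhs_left_lt.
  have x0 : 0 < x by near: x; exact: nbhs_left_gt.
  have fx : f x < 0 by near: x; exact: (cvgr_lt _ fr).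
  have := sgn x x0; rewrite leNgt => /negP; apply.
  by rewrite pmulr_rlt0 // subr_gt0.
Unshelve. all: by end_near. Qed.

Lemma sure_slope_cvg (R : realType) (N p : nat) (H : 'M[R]_N)
    (T : 'M[R]_(p, N)) (b : 'cV[R]_N) (sigma lambda : R) :
  0 < lambda -> (forall mu, 0 < mu -> tik_mx H T mu \in unitmx) ->
  sure_slope H T b sigma lambda mu @[mu --> lambda]
    --> sure_slope H T b sigma lambda lambda.
Proof.
move=> l0 uX.
have cstF m n (A : 'M[R]_(m, n)) : mx_cvg (nbhs lambda) (fun=> A) A.
  exact: mx_cvg_cst.
have Mcvg : mx_cvg (nbhs lambda) (tik_inv H T) (tik_inv H T lambda).
  apply: mx_cvg_inv; first exact: uX.
    by near=> mu; apply: uX; near: mu; exact: lt_nbhsr.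
  by apply: mx_cvgD => //; apply: mx_cvgZ => //; exact: cvg_id.
have Dcvg : mx_cvg (nbhs lambda) (fun mu =>
    H *m (tik_inv H T mu *m (T^T *m T) *m tik_inv H T lambda) *m H^T)
    (H *m (tik_inv H T lambda *m (T^T *m T) *m tik_inv H T lambda) *m H^T).
  exact: mx_cvgM (mx_cvgM (cstF _ _ _)
    (mx_cvgM (mx_cvgM Mcvg (cstF _ _ _)) (cstF _ _ _))) (cstF _ _ _).
have rcvg : mx_cvg (nbhs lambda) (residual H T b) (residual H T b lambda).
  apply: mx_cvgD (cstF _ _ (- b)).
  exact: mx_cvgM (cstF _ _ _) (mx_cvgM (mx_cvgM Mcvg (cstF _ _ _)) (cstF _ _ _)).
apply: cvgD; last by apply: cvgM; [exact: cvg_cst | exact: mx_cvg_trace].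
apply: mx_cvgM; first by apply: mx_cvg_tr; exact: mx_cvgM.
exact: mx_cvgD rcvg (cstF _ _ _).
Unshelve. all: by end_near. Qed.

Lemma sure_minimizer_slope (R : realType) (N p : nat) (H : 'M[R]_N)
    (T : 'M[R]_(p, N)) (b : 'cV[R]_N) (sigma lambda : R) :
  (forall mu, 0 < mu -> tik_mx H T mu \in unitmx) -> 0 < lambda ->
  (forall mu, 0 < mu -> sure H T b sigma lambda <= sure H T b sigma mu) ->
  sure_slope H T b sigma lambda lambda = 0.
Proof.
move=> uX l0 lmin.
apply: (@eq0_of_sign_change _ (sure_slope H T b sigma lambda) lambda) => //.
  exact: sure_slope_cvg.
by move=> mu mu0; rewrite -sure_sub ?subr_ge0 ?lmin ?uX.
Qed.

(** * Evaluation of the slope at the minimizer *)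

(** For H normal and commuting with T^T T, the matrix H M H^T equals
    M (H H^T) = M (H^T H) = 1 - lambda M T^T T. *)
Lemma residual_normal (R : realType) (N p : nat) (H : 'M[R]_N)
    (T : 'M[R]_(p, N)) (b : 'cV[R]_N) (lambda : R) :
  tik_mx H T lambda \in unitmx ->
  comm_mx H H^T -> comm_mx H (T^T *m T) ->
  residual H T b lambda = - (lambda *: (tik_inv H T lambda *m (T^T *m T) *m b)).
Proof.
move=> uX HHt HG.
have HX : comm_mx H (tik_mx H T lambda).
  apply: comm_mxD; first by apply: comm_mxM.
  by rewrite /comm_mx -scalemxAl -scalemxAr HG.
have HM : comm_mx H (tik_inv H T lambda) by exact: comm_mx_inv.
have HHtE : H *m H^T = tik_mx H T lambda - lambda *: (T^T *m T).
  by rewrite (HHt : _ = _) addrK.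
rewrite /residual /tik_sol !mulmxA (HM : _ = _) -(mulmxA _ H) HHtE mulmxBr.
by rewrite mulVmx // mulmxBl mul1mx -scalemxAr -scalemxAl addrAC subrr add0r
  !mulmxA.
Qed.

Theorem theorem3 (R : realType) (m n p : nat) (b : 'cV[R]_(m * n)) (sigma : R)
    (H : 'M[R]_(m * n)) (T : 'M[R]_(p, m * n)) :
  0 < sigma ->
  convolutional H ->
  convolutional (T^T *m T) ->
  (forall lambda : R, 0 < lambda ->
     H^T *m H + lambda *: (T^T *m T) \in unitmx) ->
  (forall lambda : R, 0 < lambda -> forall v : 'cV[R]_(m * n),
     is_argmin (tik_obj H T b lambda) v <-> v = tik_sol H T b lambda) /\
  (forall lambda : R, 0 < lambda ->
     (forall mu : R, 0 < mu ->
        sure H T b sigma lambda <= sure H T b sigma mu) ->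
     let M := tik_inv H T lambda in
     let den := (b^T *m H *m M *m T^T *m T *m M *m T^T *m T *m M *m H^T *m b) 0 0 in
     den != 0 ->
     lambda = sigma ^+ 2 * \tr (H *m M *m T^T *m T *m M *m H^T) / den).
Proof.
move=> sigma0 convH convG uX; split=> [lambda l0 v|lambda l0 lmin M den den0].
  by apply: tik_argminP => //; exact: uX.
have HHt : comm_mx H H^T by exact: convolutional_comm_tr.
have HG : comm_mx H (T^T *m T) by exact: convolutional_comm.
have HtG : comm_mx H^T (T^T *m T).
  by have := convolutional_comm_tr convG convH; exact: comm_mx_sym.
have uXl : tik_mx H T lambda \in unitmx by exact: uX.
have commM A : comm_mx A H -> comm_mx A H^T -> comm_mx A (T^T *m T) ->
    comm_mx A M.
  move=> AH AHt AG; apply: comm_mx_inv => //; apply: comm_mxD.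
    exact: comm_mxM.
  by rewrite /comm_mx -scalemxAl -scalemxAr AG.
have HtM : comm_mx H^T M by apply: commM => //; exact: comm_mx_sym.
have GM : comm_mx (T^T *m T) M by apply: commM => //; exact: comm_mx_sym.
have := sure_minimizer_slope uX l0 lmin.
have Mt : M^T = M by rewrite trmx_inv tik_mx_tr.
rewrite /sure_slope residual_normal // -/M.
have -> : ((H *m (M *m (T^T *m T) *m M) *m H^T *m b)^T
      *m (- (lambda *: (M *m (T^T *m T) *m b))
          + - (lambda *: (M *m (T^T *m T) *m b)))) 0 0 = - 2 * lambda * den.
  have HtMG : H^T *m (M *m (T^T *m T)) = T^T *m T *m M *m H^T.
    by rewrite (GM : _ = _); exact: comm_mxM.
  (* Expanding the left-hand side puts H^T right before M T^T T b, whereas in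
     den it stands next to b: [HtMG] moves it there. *)
  have -> : den = ((H *m (M *m (T^T *m T) *m M) *m H^T *m b)^T
      *m (M *m (T^T *m T) *m b)) 0 0.
    congr (fun_of_matrix _ 0 0).
    transitivity (b^T *m H *m M *m (T^T *m T) *m M
        *m (H^T *m (M *m (T^T *m T))) *m b).
      by rewrite HtMG !mulmxA.
    by rewrite !trmx_mul !trmxK Mt !mulmxA.
  (* The factor 2 is the sum of the two equal residuals. *)
  rewrite -opprD -scalerDl mulmxN -scalemxAr mxE entryZ.
  ring.
have -> : H *m (M *m (T^T *m T) *m M) *m H^T
    = H *m M *m T^T *m T *m M *m H^T by rewrite !mulmxA.
move=> slope0; apply: (mulIf den0); rewrite divfK //; lra.
Qed.
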